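(* There exists an infinite minimal topological group that is nilpotent of nilpotency class $2$, has no non-trivial convergent sequences, and has an open normal countably compact subgroup.
   Context: All topological groups are Hausdorff. A Hausdorff topological group $(G,\mathscr{T})$ is minimal if every Hausdorff group topology $\mathscr{T}'\subseteq\mathscr{T}$ on $G$ satisfies $\mathscr{T}'=\mathscr{T}$. A convergent sequence is non-trivial if it is not eventually constant; equivalently, having a non-trivial convergent sequence means containing a countably infinite subspace with exactly one non-isolated point, every neighbourhood of which contains all but finitely many points of the subspace. *)

(* Defs.v *)
From HB Require Import structures.
From mathcomp Require Import all_boot.
From mathcomp Require Import all_classical.
From mathcomp Require Import topology.

Set Implicit Arguments.
Unset Strict Implicit.
Unset Printing Implicit Defensive.

Local Open Scope classical_set_scope.
Local Open Scope group_scope.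

(* Minimality compares several topologies on one group, so a topology is a
   separate argument: [topology_on X] is the type of MathComp-Analysis
   topological structures carried by [X], and [topologize T] is [X] with the
   structure [T].  (Such a structure also contains a choice structure, which
   plays no role here.) *)
Definition topology_on (X : Type) : Type := Topological.axioms_ X.

Definition topologize (X : Type) (T : topology_on X) : topologicalType :=
  Topological.Pack T.

Definition opens (X : Type) (T : topology_on X) : set (set X) :=
  @open (topologize T).

Definition hausdorff_group_topology (G : groupType) (T : topology_on G) :
    Prop :=
  let X := topologize T in
  [/\ continuous ((fun p => (p.1 : G) * (p.2 : G)) : X * X -> X),
      continuous ((fun x => (x : G)^-1) : X -> X)
    & hausdorff_space X].

Definition minimal_topological_group (G : groupType) (T : topology_on G) :
    Prop :=
  hausdorff_group_topology T /\
  forall T' : topology_on G, hausdorff_group_topology T' ->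
    opens T' `<=` opens T -> opens T' = opens T.

Definition subgroup (G : groupType) (H : set G) : Prop :=
  group_closed (mem H).

Definition normal_subgroup (G : groupType) (H : set G) : Prop :=
  subgroup H /\ forall x y : G, H x -> H (x ^ y).

(* Indexed from 0: [lower_central_series G 0] is [G] itself. *)
Fixpoint lower_central_series (G : groupType) (n : nat) : set G :=
  if n is m.+1 then
    smallest (@subgroup G)
      [set [~ x, y] | x in @lower_central_series G m & y in [set: G]]
  else [set: G].

Definition nilpotent_of_class (G : groupType) (c : nat) : Prop :=
  @lower_central_series G c = [set 1] /\
  forall m : nat, (m < c)%N -> @lower_central_series G m <> [set 1].

Definition countably_compact (X : topologicalType) (A : set X) : Prop :=
  forall C : set (set X), countable C -> C `<=` open ->
    A `<=` \bigcup_(U in C) U ->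
    exists D : set (set X),
      [/\ finite_set D, D `<=` C & A `<=` \bigcup_(U in D) U].

Definition eventually_constant (X : Type) (u : nat -> X) : Prop :=
  exists c : X, \forall n \near \oo, u n = c.

Definition no_nontrivial_convergent_sequence (X : topologicalType) : Prop :=
  forall (u : nat -> X) (l : X), u @ \oo --> l -> eventually_constant u.

(* Main.v *)
From HB Require Import structures.
Require Import Defs.
From mathcomp Require Import all_boot.
From mathcomp Require Import ssralg.
From mathcomp Require Import all_classical.
From mathcomp Require Import topology.

(** An infinite countably compact boolean group [V] without non-trivial
    convergent sequences is built together with a group [F] of homomorphisms
    from [V] to the two-element group that separates points and induces the
    topology of [V]; the required group is the Heisenberg group of the pairing
    of [F] with [V].

    The group [V] follows Hrusak, van Mill, Ramos-Garcia and Shelah.  It is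
    the free boolean group on a set of countably branching trees, chosen so
    that every sequence [x] of elements of [V] is the sequence [terms t]
    attached to (at least two) trees [t], all of whose constituents are
    strictly smaller trees.  Each [t] carries an ultrafilter, and [F] consists
    of the [phi] such that, whenever the sequence [terms t] is linearly
    independent, [phi t] is the limit of [phi (terms t n)] along the
    ultrafilter of [t].  In the topology induced by [F] the point [t] is then
    a cluster point of [terms t].  A sequence in [V] either repeats a value
    infinitely often or has an independent subsequence, because finite sets
    span finite subgroups.  Hence every sequence has a cluster point, and a
    sequence that takes infinitely many values has two different ones, one for
    each tree encoding an independent subsequence; so it does not converge.

    All this needs [F] to separate the points of [V]
    ([limit_chars_separate]).  For [v <> 0], only a countable set of trees,
    closed under passing to constituents, matters at first; a character found
    there extends to all trees by recursion, taking limits along the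
    ultrafilters ([limit_extension]).  On the countable set it suffices to
    find a subgroup that avoids [v] and contains [terms t n + t] for almost
    all [n], for each [t] ([separating_subgroup]).  The ultrafilters are
    prepared for this.  The natural numbers are cut into rapidly growing
    blocks, different trees own almost disjoint sets of blocks, and the
    ultrafilter of [t] ignores every set that meets each block of [t] in few
    points.  Countably many trees can then share the blocks so that each block
    serves a single tree and each tree loses finitely many blocks, and the
    subgroup is generated greedily: counting dimensions, a block beginning at
    [a] contains at most [a + 1] points whose vector has to be rejected
    ([greedy_subgroup]).

    Minimality of the Heisenberg group ([heis_minimal]) is an argument with
    commutators, after Megrelishvili.  In any coarser Hausdorff group topology
    the commutator map, whose values are the two central elements, is still
    continuous and its values are still separated; this makes every map
    [w phi] of the [V]-coordinate continuous, and then forces the remaining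
    two coordinates to be continuous as well. *)

Set Implicit Arguments.
Unset Strict Implicit.
Unset Printing Implicit Defensive.

Import GRing.Theory.

Local Open Scope classical_set_scope.

(** * Heisenberg groups of boolean pairings *)

(** The two separation fields already force [V] and [F] to have exponent two,
    since the values are booleans. *)
Record pairing (V F : zmodType) := Pairing {
  pairing_fun :> F -> V -> bool;
  pairDl : forall phi psi v,
    pairing_fun (phi + psi)%R v = pairing_fun phi v (+) pairing_fun psi v;
  pairDr : forall phi u v,
    pairing_fun phi (u + v)%R = pairing_fun phi u (+) pairing_fun phi v;
  pair_eq0l : forall phi, (forall v, pairing_fun phi v = false) -> phi = 0%R;
  pair_eq0r : forall v, (forall phi, pairing_fun phi v = false) -> v = 0%R }.

Section PairingTheory.
Variables (V F : zmodType) (w : pairing V F).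

Lemma pair0r phi : w phi 0%R = false.
Proof. by have := pairDr w phi 0%R 0%R; rewrite addr0 addbb. Qed.

Lemma pair0l v : w 0%R v = false.
Proof. by have := pairDl w 0%R 0%R v; rewrite addr0 addbb. Qed.

Lemma pairNr phi v : w phi (- v)%R = w phi v.
Proof.
have := pairDr w phi v (- v)%R; rewrite addrN pair0r.
by case: (w phi v); case: (w phi _).
Qed.

Lemma pairNl phi v : w (- phi)%R v = w phi v.
Proof.
have := pairDl w phi (- phi)%R v; rewrite addrN pair0l.
by case: (w phi v); case: (w _ v).
Qed.

Definition annihilator (s : seq F) : set V :=
  [set v | forall phi, phi \in s -> w phi v = false].

(** This replaces the fact that a functional vanishing on the annihilator of
    [s] lies in the finite span of [s]: the values at finitely many test
    vectors, one for each drop in the chain of annihilators, decide whether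
    such a functional is zero. *)
Lemma annihilator_detect (s : seq F) : exists r : seq V, forall psi,
  (forall v, annihilator s v -> w psi v = false) ->
  (forall v, v \in r -> w psi v = false) -> psi = 0%R.
Proof.
elim: s => [|phi s [r IHr]].
  by exists [::] => psi psi0 _; apply: (pair_eq0l (p := w)) => v; apply: psi0.
have [[u [su phiu]]|/forallNP nou] :=
  pselect (exists u, annihilator s u /\ w phi u = true).
- exists (u :: r) => psi psi0 psir; apply: IHr => [v sv|v vr]; last first.
    by apply: psir; rewrite inE vr orbT.
  have psiu : w psi u = false by apply: psir; rewrite mem_head.
  case phiv : (w phi v).
    have : w psi (v + u)%R = false.
      apply: psi0 => chi; rewrite inE => /predU1P[->|chis]; rewrite pairDr.
        by rewrite phiv phiu.
      by rewrite sv ?su.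
    by rewrite pairDr psiu addbF.
  by apply: psi0 => chi; rewrite inE => /predU1P[->//|chis]; apply: sv.
- exists r => psi psi0 psir; apply: IHr => // v sv; apply: psi0 => chi.
  rewrite inE => /predU1P[->|]; last exact: sv.
  by apply: contra_notF (nou v) => phiv; split.
Qed.

End PairingTheory.

(** The first coordinate spans the centre; the last one acts on the other two
    by transvections. *)
Definition heisenberg (V F : zmodType) (w : pairing V F) : Type :=
  (bool * V * F)%type.

HB.instance Definition _ (V F : zmodType) (w : pairing V F) :=
  Choice.copy (heisenberg w) (bool * V * F)%type.

Section HeisenbergGroup.
Variables (V F : zmodType) (w : pairing V F).
Implicit Types x y z : heisenberg w.

Definition heis_mul x y : heisenberg w :=
  (x.1.1 (+) y.1.1 (+) w x.2 y.1.2, (x.1.2 + y.1.2)%R, (x.2 + y.2)%R).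

Definition heis_one : heisenberg w := (false, 0%R, 0%R).

Definition heis_inv x : heisenberg w :=
  (x.1.1 (+) w x.2 x.1.2, (- x.1.2)%R, (- x.2)%R).

Lemma heis_mulA : associative heis_mul.
Proof.
move=> [[a v] f] [[b u] g] [[c t] h]; rewrite /heis_mul /= !addrA pairDl pairDr.
by congr (_, _, _); case: a b c (w _ _) (w _ _) (w _ _) => [] [] [] [] [] [].
Qed.

Lemma heis_mul1 : left_id heis_one heis_mul.
Proof. by move=> [[a v] f]; rewrite /heis_mul /= !add0r pair0l addbF. Qed.

Lemma heis_1mul : right_id heis_one heis_mul.
Proof. by move=> [[a v] f]; rewrite /heis_mul /= !addr0 pair0r !addbF. Qed.

Lemma heis_mulV : left_inverse heis_one heis_inv heis_mul.
Proof.
move=> [[a v] f]; rewrite /heis_mul /= !addNr pairNl.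
by congr (_, _, _); case: a (w _ _) => [] [].
Qed.

Lemma heis_Vmul : right_inverse heis_one heis_inv heis_mul.
Proof.
move=> [[a v] f]; rewrite /heis_mul /= !addrN pairNr.
by congr (_, _, _); case: a (w _ _) => [] [].
Qed.

HB.instance Definition _ := isGroup.Build (heisenberg w)
  heis_mulA heis_mul1 heis_1mul heis_mulV heis_Vmul.

Lemma heis_mulE x y : (x * y)%g = heis_mul x y. Proof. by []. Qed.
Lemma heis_invE x : (x^-1)%g = heis_inv x. Proof. by []. Qed.

Definition central (a : bool) : heisenberg w := (a, 0%R, 0%R).

Lemma heis_commE x y :
  [~ x, y]%g = central (w x.2 y.1.2 (+) w y.2 x.1.2).
Proof.
rewrite commgEl conjgE !heis_mulE !heis_invE.
case: x y => [[a v] f] [[b u] g].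
rewrite /heis_mul /heis_inv /central /= !pairDr !pairNl !pairNr.
congr (_, _, _); last 2 first.
- by rewrite (addrC v) [(- u + _)%R]addrA addNr add0r addNr.
- by rewrite (addrC f) [(- g + _)%R]addrA addNr add0r addNr.
by case: a b (w f v) (w f u) (w g v) (w g u) => [] [] [] [] [] [].
Qed.

End HeisenbergGroup.

Section HeisenbergTopology.
Variables (V F : zmodType) (w : pairing V F).
Implicit Types x y z : heisenberg w.

(** A base of the product topology in which the first and the last coordinate
    are discrete and [V] has the topology induced by [w]. *)
Definition heis_ball x (s : seq F) : set (heisenberg w) :=
  [set y | [/\ y.1.1 = x.1.1, y.2 = x.2
             & forall phi, phi \in s -> w phi y.1.2 = w phi x.1.2]].

Definition heis_nbhs x (A : set (heisenberg w)) : Prop :=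
  exists s, heis_ball x s `<=` A.

HB.instance Definition _ := hasNbhs.Build (heisenberg w) heis_nbhs.

Lemma heis_ball_eq x s y : heis_ball x s y -> heis_ball y s = heis_ball x s.
Proof.
move=> [xy1 xy2 xys]; apply/seteqP; split=> t [t1 t2 ts].
  by split=> [||phi phis]; rewrite ?t1 ?t2 ?ts ?xys.
by split=> [||phi phis]; rewrite ?t1 ?t2 ?ts ?xys.
Qed.

Lemma heis_nbhs_filter x : ProperFilter (heis_nbhs x).
Proof.
split; first by move=> [s /(_ x)]; apply.
split; first by exists [::].
- move=> A B [s sA] [t tB]; exists (s ++ t) => y [y1 y2 ys]; split.
    by apply: sA; split=> // phi phis; apply: ys; rewrite mem_cat phis.
  by apply: tB; split=> // phi phit; apply: ys; rewrite mem_cat phit orbT.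
- by move=> A B AB [s sA]; exists s; apply: subset_trans AB.
Qed.

Lemma heis_nbhs_singleton x A : heis_nbhs x A -> A x.
Proof. by move=> [s]; apply. Qed.

Lemma heis_nbhs_nbhs x A : heis_nbhs x A -> heis_nbhs x (heis_nbhs^~ A).
Proof.
by move=> [s sA]; exists s => y xy; exists s; rewrite (heis_ball_eq xy).
Qed.

HB.instance Definition _ := Nbhs_isNbhsTopological.Build (heisenberg w)
  heis_nbhs_filter heis_nbhs_singleton heis_nbhs_nbhs.

Definition heis_topology : topology_on (heisenberg w) :=
  Topological.class (heisenberg w).

Lemma heis_hausdorff_group_topology : hausdorff_group_topology heis_topology.
Proof.
split.
- move=> [x y] A [s sA] /=.
  exists (heis_ball x s, heis_ball y (x.2 :: s)) => /=.
    by split; [exists s | exists (x.2 :: s)].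
  move=> [x' y'] /= [[x1 x2 xs] [y1 y2 ys]]; apply: sA; rewrite !heis_mulE.
  split => /=; first by rewrite x1 x2 y1 ys ?mem_head.
    by rewrite x2 y2.
  by move=> phi phis; rewrite !pairDr xs// ys// inE phis orbT.
- move=> x A [s sA] /=; exists (x.2 :: s) => y [y1 y2 ys]; apply: sA.
  rewrite !heis_invE; split => /=; first by rewrite y1 y2 ys ?mem_head.
    by rewrite y2.
  by move=> phi phis; rewrite !pairNr ys// inE phis orbT.
- move=> [[a v] f] [[b u] g] xy.
  have [z [[/= z1 z2 _] [/= z1' z2' _]]] :
      heis_ball (a, v, f) [::] `&` heis_ball (b, u, g) [::] !=set0.
    by apply: xy; exists [::].
  suff uv : v = u by rewrite uv -z1 -z1' -z2 -z2'.
  apply/eqP; rewrite -subr_eq0; apply/eqP; apply: (pair_eq0r (p := w)) => phi.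
  have [t [[_ _ /= t3] [_ _ /= t3']]] :
      heis_ball (a, v, f) [:: phi] `&` heis_ball (b, u, g) [:: phi] !=set0.
    by apply: xy; exists [:: phi].
  by rewrite pairDr pairNr -t3 ?mem_head// -t3' ?mem_head// addbb.
Qed.

End HeisenbergTopology.

Section HausdorffGroupTopology.
Variables (G : groupType) (T : topology_on G).
Hypothesis TH : hausdorff_group_topology T.
Let X := topologize T.

Lemma nbhs_neq (x z : G) : x <> z -> @nbhs X X x (~` [set z]).
Proof.
case: TH => _ _ hT xz; apply: open_nbhs_nbhs; split => //.
by apply/closed_openC/accessible_closed_set1/hausdorff_accessible.
Qed.

Lemma mul_nbhs (x y : G) (S : set G) : @nbhs X X (x * y)%g S ->
  exists A B : set G, [/\ @nbhs X X x A, @nbhs X X y B &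
    forall a b, A a -> B b -> S (a * b)%g].
Proof.
case: TH => mulc _ _ /(mulc (x, y)) [[A B] /= [xA yB] AB].
by exists A, B; split => // a b Aa Bb; apply: (AB (a, b)).
Qed.

Lemma inv_nbhs (x : G) (S : set G) : @nbhs X X x^-1%g S ->
  @nbhs X X x [set y | S y^-1%g].
Proof. by case: TH => _ invc _ /invc. Qed.

(** Separate continuity in each argument would not be enough: minimality uses
    that commutators of two elements close to [1] are close to [1]. *)
Lemma commg_nbhs (x y : G) (S : set G) : @nbhs X X [~ x, y]%g S ->
  exists A B : set G, [/\ @nbhs X X x A, @nbhs X X y B &
    forall a b, A a -> B b -> S [~ a, b]%g].
Proof.
rewrite commgEl conjgE => /mul_nbhs [A1 [S1 [/inv_nbhs xA1 S1n S1S]]].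
have [B1 [S2 [/inv_nbhs yB1 S2n S2S]]] := mul_nbhs S1n.
have [A2 [B2 [xA2 yB2 AB]]] := mul_nbhs S2n.
eexists; eexists; split; [exact: filterI xA1 xA2|exact: filterI yB1 yB2|].
move=> a b [a1 a2] [b1 b2]; rewrite commgEl conjgE.
by apply: S1S => //; apply: S2S => //; apply: AB.
Qed.

End HausdorffGroupTopology.

Section GroupTopology.
Variables (G : groupType) (T T' : topology_on G).
Hypothesis TH : hausdorff_group_topology T.
Hypothesis TH' : hausdorff_group_topology T'.

Lemma opens_subset_nbhs1 :
  (forall A, @nbhs (topologize T) (topologize T) 1%g A ->
     @nbhs (topologize T') (topologize T') 1%g A) ->
  opens T `<=` opens T'.
Proof.
move=> nbhs1 O; rewrite /opens !openE => oO x Ox.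
have {oO Ox} := oO _ Ox; rewrite /interior -{1}[x]mulg1.
move=> /(mul_nbhs TH)[A [B [xA /nbhs1 B1 ABO]]].
have := B1; rewrite -{1}(mulVg x) => /(mul_nbhs TH')[C [D [Cx Dx CDB]]].
apply: filterS Dx => y Dy; rewrite -(mulVKg x y).
by apply: ABO; [exact: nbhs_singleton xA|];
  apply: CDB Dy; apply: nbhs_singleton Cx.
Qed.

End GroupTopology.

Section HeisenbergMinimal.
Variables (V F : zmodType) (w : pairing V F).

(** Commuting with a fixed element is the condition [w phi x.1.2 = false] or
    [w x.2 v = false], according to the element.  As commutators are central
    and the central element [central w true] has a complement that is a
    neighbourhood of [1], this condition defines a neighbourhood of [1] in
    every Hausdorff group topology. *)
Lemma coordinate_kernel_nbhs (T' : topology_on (heisenberg w)) :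
  hausdorff_group_topology T' ->
  (forall phi, @nbhs (topologize T') (topologize T') 1%g
     [set x : heisenberg w | w phi x.1.2 = false]) /\
  (forall v, @nbhs (topologize T') (topologize T') 1%g
     [set x : heisenberg w | w x.2 v = false]).
Proof.
move=> TH'.
have z1 : 1%g <> central w true by [].
split=> [phi|v].
- have zn := nbhs_neq TH' z1.
  rewrite -(comm1g ((false, 0, phi)%R : heisenberg w)) in zn.
  have {zn} [A [B [A1 /nbhs_singleton Bp AB]]] := commg_nbhs TH' zn.
  apply: filterS A1 => x Ax /=; apply: contra_notF (AB _ _ Ax Bp) => phix.
  by rewrite heis_commE /= pair0r phix.
- have zn := nbhs_neq TH' z1.
  rewrite -(comm1g ((false, v, 0)%R : heisenberg w)) in zn.
  have {zn} [A [B [A1 /nbhs_singleton Bp AB]]] := commg_nbhs TH' zn.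
  apply: filterS A1 => x Ax /=; apply: contra_notF (AB _ _ Ax Bp) => xv.
  by rewrite heis_commE /= pair0l xv.
Qed.

Lemma nbhs_all (X : topologicalType) (x : X) (I : eqType) (s : seq I)
    (A : I -> set X) :
  (forall i, nbhs x (A i)) -> nbhs x [set y | forall i, i \in s -> A i y].
Proof.
move=> xA; elim: s => [|i s IHs]; first exact: nearW.
apply: filterS2 (xA i) IHs => y Aiy sy j; rewrite inE.
by move=> /predU1P[->|/sy].
Qed.

(** In a coarser topology [T'] take neighbourhoods [Q1], [Q2] of [1] whose
    commutators avoid the central involution.  Since [Q2] is also a
    neighbourhood for the finer topology, the last coordinate of an element of
    [Q1] vanishes on an annihilator, and finitely many further conditions make
    it zero.  Once it is zero, two neighbourhoods [P1], [P2] whose products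
    avoid the central involution make the first coordinate vanish. *)
Lemma heis_minimal : minimal_topological_group (heis_topology w).
Proof.
have TH := heis_hausdorff_group_topology w.
split=> // T' TH' T'T; apply/seteqP; split => //.
apply: (opens_subset_nbhs1 TH TH') => A [s sA].
set X := topologize T'.
have toT B : @nbhs X X 1%g B ->
    exists t, heis_ball (1%g : heisenberg w) t `<=` B.
  rewrite nbhsE => -[U [oU U1] UB].
  have := T'T _ oU; rewrite /opens openE => /(_ _ U1)[t tU].
  by exists t; apply: subset_trans UB.
have [kerl kerr] := coordinate_kernel_nbhs TH'.
have zN : @nbhs X X 1%g (~` [set central w true]) by apply: nbhs_neq.
have zM := zN; rewrite -{1}(mulg1 1%g) in zM.
have {zM} [P1 [P2 [P1n P2n Pz]]] := mul_nbhs TH' zM.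
have zC := zN; rewrite -{1}(commg1 1%g) in zC.
have {zC} [Q1 [Q2 [Q1n Q2n Qz]]] := commg_nbhs TH' zC.
have [t tP] := toT _ P2n.
have [q qQ] := toT _ Q2n.
have [r rq] := annihilator_detect w q.
have sn := nbhs_all (s ++ t) kerl.
have rn := nbhs_all r kerr.
apply: filterS (filterI (filterI P1n Q1n) (filterI sn rn)).
move=> [[a v] psi] [[Px Qx] [/= svt psir]].
(* The commutator of [(a, v, psi)] with [(false, u, 0)] is [psi u]. *)
have psi0 : psi = 0%R.
  apply: rq psir => u uq.
  apply: contra_notF (Qz _ (false, u, 0%R) Qx _) => [psiu|].
    by rewrite heis_commE /= psiu pair0l.
  by apply: qQ; split => //= phi /uq; rewrite pair0r.
apply: sA; split => //=; last first.
  by move=> phi phis; rewrite pair0r svt// mem_cat phis.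
(* If [a] were true, the product with [(false, - v, 0)] would be the central
   involution. *)
apply/negbTE; apply: contra_notN (Pz _ (false, (- v)%R, 0%R) Px _) => [a1|].
  by rewrite heis_mulE /heis_mul /= a1 psi0 pair0l addrN addr0.
apply: tP; split => //= phi phit.
by rewrite pairNr pair0r svt// mem_cat phit orbT.
Qed.

Lemma heis_nilpotent (v0 : V) : v0 <> 0%R ->
  nilpotent_of_class (heisenberg w) 2.
Proof.
move=> v0N.
have subE (H : set (heisenberg w)) : subgroup H <->
    H 1%g /\ forall x y, H x -> H y -> H (x / y)%g.
  rewrite /subgroup /group_closed; split=> -[H1 HD]; split.
  - by move: H1; rewrite inE.
  - by move=> x y Hx Hy; have := HD x y; rewrite !inE; apply.
  - by rewrite inE.
  - by move=> x y; rewrite !inE; apply: HD.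
have smallest1 (A : set (heisenberg w)) : A `<=` [set 1%g] ->
    smallest (@subgroup (heisenberg w)) A = [set 1%g].
  move=> A1; apply/seteqP; split=> [x /(_ [set 1%g])|x -> H [/subE[]//]].
  apply; split=> //; apply/subE; split=> // _ _ -> ->.
  by rewrite divg1.
have central1 :
    @lower_central_series (heisenberg w) 1 `<=` [set central w a | a in setT].
  move=> x; apply; split.
    apply/subE; split; first by exists false.
    move=> _ _ [a _ <-] [b _ <-]; exists (a (+) b) => //.
    rewrite heis_mulE heis_invE /heis_mul /heis_inv /central /=.
    by rewrite !pair0r !oppr0 !addr0 pair0r !addbF.
  by move=> _ [a _ [b _ <-]]; rewrite heis_commE; eexists.
split.
  apply: smallest1 => _ [_ /central1[a _ <-] [y _ <-]].
  by rewrite /= heis_commE /= pair0l pair0r.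
have [psi psiv0] : exists psi, w psi v0 = true.
  apply/not_existsP => wv0; apply: v0N; apply: (pair_eq0r (p := w)) => phi.
  by apply/negbTE/negP; apply: wv0.
case=> [_|[_|//]].
  move=> /seteqP[/(_ (central w true))]; rewrite /=.
  by move=> /(_ Logic.I) [].
move=> /seteqP[/(_ (central w true))] H _; suff /H : 
  @lower_central_series (heisenberg w) 1 (central w true) by [].
move=> H' [_]; apply.
exists (false, 0%R, psi) => //; exists (false, v0, 0%R) => //.
by rewrite heis_commE /= psiv0 pair0l.
Qed.

Definition base_subgroup : set (heisenberg w) := [set x | x.2 = 0%R].

Lemma base_subgroup_normal : normal_subgroup base_subgroup.
Proof.
split.
  split; first by rewrite inE.
  by move=> x y; rewrite !inE /base_subgroup /= => -> ->; rewrite oppr0 addr0.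
move=> x y x0; rewrite conjgE /base_subgroup !heis_mulE heis_invE /=.
by rewrite [x.2]x0 add0r addNr.
Qed.

Lemma base_subgroup_open : opens (heis_topology w) base_subgroup.
Proof.
rewrite /opens openE => x x0; exists [::] => y [_ y2 _].
by rewrite /base_subgroup /= y2.
Qed.

Lemma heis_no_convergent :
  (forall (u : nat -> V) l,
    (forall phi, \forall n \near \oo, w phi (u n) = w phi l) ->
    \forall n \near \oo, u n = l) ->
  no_nontrivial_convergent_sequence (topologize (heis_topology w)).
Proof.
move=> ncV u l ul; exists l.
have uball t : \forall n \near \oo, heis_ball (l : heisenberg w) t (u n).
  by apply: ul; exists t.
have ulV : \forall n \near \oo,
    (u n : heisenberg w).1.2 = (l : heisenberg w).1.2.
  apply: (ncV (fun n => (u n : heisenberg w).1.2)) => phi.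
  by apply: filterS (uball [:: phi]) => n [_ _]; apply; rewrite mem_head.
apply: filterS2 ulV (uball [::]) => n ln [l1 l2 _].
by move: (u n) l l1 l2 ln {ul uball} => [[a v] f] [[b v'] f'] /= -> -> ->.
Qed.

(** Sequential form of countable compactness: an increasing enumeration of a
    countable cover without finite subcover yields a sequence whose cluster
    points are not covered. *)
Lemma base_subgroup_countably_compact :
  (forall u : nat -> V, exists v, forall (s : seq F) N,
     exists2 n, (N <= n)%N & forall phi, phi \in s -> w phi (u n) = w phi v) ->
  @countably_compact (topologize (heis_topology w)) base_subgroup.
Proof.
move=> ccV C /countable_injP[f finj] Copen Ccov; apply/not_existsP => nofin.
pose D n : set (set (heisenberg w)) := C `&` [set U | (f U <= n)%N].
have /choice[u uP] n : exists x, base_subgroup x /\ ~ (\bigcup_(U in D n) U) x.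
  apply/not_existsP => all_in; apply: (nofin (D n)); split.
  - have fD : {in D n &, injective f}.
      by move=> U U'; rewrite !inE => -[CU _] [CU' _]; apply: finj; rewrite inE.
    rewrite -(eq_finite_set (inj_card_eq fD)).
    by apply: sub_finite_set (finite_II n.+1) => _ [U [_ Un] <-].
  - by move=> U [].
  - by move=> x Hx; apply: contrapT => xD; apply: (all_in x).
have [v vP] := ccV (fun n => (u n).1.2).
(* The boolean coordinate needs no further subsequence: a refutation of both
   values would contradict the cluster property for the union of the two
   finite sets of functionals. *)
have [a aP] : exists a, forall s N, exists2 n, (N <= n)%N &
    heis_ball ((a, v, 0%R) : heisenberg w) s (u n).
  apply/not_existsP => noa.
  have {}noa a : exists sN : seq F * nat, forall n, (sN.2 <= n)%N ->
      ~ heis_ball ((a, v, 0%R) : heisenberg w) sN.1 (u n).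
    apply/not_existsP => Na; apply: (noa a) => s N.
    by have /existsNP[n /not_implyP[Nn /contrapT]] := Na (s, N); exists n.
  have [[s M] /= sM] := noa true; have [[t N] /= tN] := noa false.
  have [n + un] := vP (s ++ t) (maxn M N); rewrite geq_max => /andP[Mn Nn].
  have [u0 _] := uP n; case ea : ((u n).1.1).
    apply: (sM _ Mn); split => // phi phis; apply: un.
    by rewrite mem_cat phis.
  apply: (tN _ Nn); split => // phi phit; apply: un.
  by rewrite mem_cat phit orbT.
have [U CU Ux] : (\bigcup_(U in C) U) (a, v, 0%R) by apply: Ccov.
have := Copen _ CU; rewrite openE => /(_ _ Ux)[s sU].
have [n fUn un] := aP s (f U).
by have [_] := uP n; apply; exists U => //; apply: sU.
Qed.

End HeisenbergMinimal.

(** * Linear independence in boolean groups *)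

Section BooleanSpan.
Variable V : zmodType.
Hypothesis addvv : forall v : V, (v + v = 0)%R.
Implicit Types (u v : V) (s t : seq V) (x : nat -> V).

(** All subset sums are listed, with repetitions, so that linear independence
    is the absence of repetitions and dimension is counted by
    [size_span]. *)
Fixpoint span s : seq V :=
  if s is v :: s' then span s' ++ [seq (v + u)%R | u <- span s'] else [:: 0%R].

Definition free s : bool := uniq (span s).

Definition free_sequence x : Prop := forall n, free [seq x i | i <- iota 0 n].

Lemma oppv v : (- v = v)%R.
Proof. by rewrite -[LHS]add0r -(addvv v) addrK. Qed.

Lemma addvK u v : (u + (u + v) = v)%R.
Proof. by rewrite addrA addvv add0r. Qed.

Lemma size_span s : size (span s) = (2 ^ size s)%N.
Proof.
by elim: s => //= v s IHs; rewrite size_cat size_map IHs expnS mul2n addnn.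
Qed.

Lemma mem_span_cons v s u :
  (u \in span (v :: s)) = (u \in span s) || ((v + u)%R \in span s).
Proof.
rewrite /= mem_cat; congr orb; apply/mapP/idP => [[u' su' ->]|vus].
  by rewrite addvK.
by exists (v + u)%R; rewrite ?addvK.
Qed.

Lemma span0 s : 0%R \in span s.
Proof. by elim: s => [|v s IHs]; rewrite ?mem_span_cons ?IHs// inE. Qed.

Lemma spanD s u v : u \in span s -> v \in span s -> (u + v)%R \in span s.
Proof.
elim: s u v => [|a s IHs] u v.
  by rewrite !inE => /eqP-> /eqP->; rewrite addr0.
rewrite !mem_span_cons => /orP[su|su] /orP[sv|sv].
- by rewrite (IHs u v).
- by rewrite addrCA (IHs u (a + v)%R) ?orbT.
- by rewrite addrA (IHs (a + u)%R v) ?orbT.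
- suff -> : (u + v = (a + u) + (a + v))%R by rewrite (IHs (a + u)%R (a + v)%R).
  by rewrite addrACA addvv add0r.
Qed.

Lemma sub_span s : {subset s <= span s}.
Proof.
elim: s => // v s IHs u; rewrite mem_span_cons inE => /predU1P[->|/IHs->//].
by rewrite addvv span0 orbT.
Qed.

Lemma span_sub s t : {subset s <= span t} -> {subset span s <= span t}.
Proof.
elim: s => [|v s IHs] st u; first by rewrite inE => /eqP->; apply: span0.
have {}IHs : {subset span s <= span t}.
  by apply: IHs => u' su'; apply: st; rewrite inE su' orbT.
rewrite mem_span_cons => /orP[/IHs//|/IHs vut].
by rewrite -(addvK v u) spanD// st// mem_head.
Qed.

Lemma span_mono s t : {subset s <= t} -> {subset span s <= span t}.
Proof. by move=> st; apply: span_sub => u /st /sub_span. Qed.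

Lemma free_cons v s : free (v :: s) = (v \notin span s) && free s.
Proof.
rewrite /free /= cat_uniq map_inj_uniq; last exact: addrI.
case: (uniq (span s)) => /=; rewrite ?andbF ?andbT//.
congr (~~ _); apply/hasP/idP => [[_ /mapP[u su ->] svu]|sv].
  by rewrite -(addvK u v) [(u + v)%R]addrC spanD.
by exists v => //; apply/mapP; exists 0%R; rewrite ?span0 ?addr0.
Qed.

Lemma free_catr s t : free (s ++ t) -> free t.
Proof. by elim: s => //= v s IHs; rewrite free_cons => /andP[_ /IHs]. Qed.

(** Steinitz' inequality, by comparing the numbers of subset sums. *)
Lemma free_sub_size s t :
  free s -> {subset s <= span t} -> (size s <= size t)%N.
Proof.
move=> fs /span_sub /(uniq_leq_size fs).
by rewrite !size_span leq_exp2l.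
Qed.

Lemma eq_mem_free s t : s =i t -> size s = size t -> free s = free t.
Proof.
move=> st sz; apply: eq_uniq; first by rewrite !size_span sz.
by move=> u; apply/idP/idP; apply: span_mono => u'; rewrite st.
Qed.

Lemma free_sequence_iota x a l :
  free_sequence x -> free [seq x i | i <- iota a l].
Proof. by move=> /(_ (a + l)%N); rewrite iotaD add0n map_cat => /free_catr. Qed.

(** The functional [psi] counts the parity of the number of terms in a sum of
    [x i + d], hence recovers the sum of the [x i]. *)
Lemma free_sequence_shift (psi : V -> bool) d x :
  (forall u v, psi (u + v)%R = psi u (+) psi v) ->
  psi d = true -> (forall i, psi (x i) = false) ->
  free_sequence x -> free_sequence (fun i => x i + d)%R.
Proof.
move=> psiD psid psix xfree n; move: (xfree n).
elim: (iota 0 n) => // i s IHs.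
rewrite ![map _ _]/= !free_cons => /andP[xis /IHs->].
rewrite andbT; apply: contra xis.
have spanP u : u \in span [seq (x i + d)%R | i <- s] ->
    (if psi u then u + d else u)%R \in span [seq x i | i <- s].
  elim: s {IHs} u => [|j s IHs] u.
    rewrite inE => /eqP->; have := psiD 0%R 0%R.
    by rewrite addr0 addbb => ->; rewrite inE.
  rewrite ![map _ _]/= !mem_span_cons => /orP[/IHs->//|/IHs].
  rewrite !psiD psix psid; case: (psi u) => /= => [|]; rewrite -!addrA.
    by rewrite [(d + _)%R]addrC => ->; rewrite orbT.
  by rewrite [(u + d)%R]addrC addvK => ->; rewrite orbT.
by move=> /spanP; rewrite psiD psix psid /= -addrA addvv addr0.
Qed.

(** Scan the sequence and keep [x i] unless it lies in the span of [v] and the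
    terms kept before; the kept terms then never generate [v].  If the terms in
    an interval of length [l] starting at [a] are independent, they lie in the
    span of [v], at most [a] earlier kept terms and the terms kept in the
    interval, so by Steinitz at least [l - (a + 1)] terms of the interval are
    kept. *)
Lemma greedy_subgroup x v : v <> 0%R -> exists M : set V,
  [/\ M 0%R, forall u u', M u -> M u' -> M (u + u')%R, ~ M v &
      forall a l, free [seq x i | i <- iota a l] ->
        (count (fun i => ~~ `[< M (x i) >]) (iota a l) <= a.+1)%N].
Proof.
move=> v0.
pose L := fix L i : seq V := if i is j.+1 then
  (if x j \notin span (v :: L j) then x j :: L j else L j) else [::].
pose kept i := x i \notin span (v :: L i).
have LS i : L i.+1 = if kept i then x i :: L i else L i by [].
have Lmono i j : (i <= j)%N -> {subset L i <= L j}.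
  elim: j => [|j IHj]; first by rewrite leqn0 => /eqP->.
  rewrite leq_eqVlt => /predU1P[->//|/IHj ij] u /ij; rewrite LS.
  by case: ifP => // _ uj; rewrite inE uj orbT.
have vL i : v \notin span (L i).
  elim: i => [|i IHi]; first by rewrite inE; apply/eqP.
  rewrite LS; case: ifP => // keepi; rewrite mem_span_cons negb_or IHi /=.
  apply: contra keepi => xvL.
  by rewrite mem_span_cons [(v + _)%R]addrC xvL orbT.
have xL i : x i \in span (v :: L i.+1).
  rewrite LS; case: ifP => [_|/negbFE//].
  by apply: sub_span; rewrite !inE eqxx orbT.
have sizeL a l : size (L (a + l)%N) = (size (L a) + count kept (iota a l))%N.
  elim: l => [|l IHl]; first by rewrite !addn0.
  rewrite addnS LS -addn1 iotaD count_cat addnA -IHl /= addn0.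
  by case: (kept _); rewrite ?addn1 ?addn0.
have sizeLa a : (size (L a) <= a)%N.
  by rewrite -[a]add0n sizeL /= (leq_trans (count_size _ _))// size_iota.
exists [set u | exists i, u \in span (L i)]; split.
- by exists 0; apply: span0.
- move=> u u' [i ui] [j uj]; exists (maxn i j); apply: spanD.
    exact: span_mono (Lmono _ _ (leq_maxl i j)) _ ui.
  exact: span_mono (Lmono _ _ (leq_maxr i j)) _ uj.
- by move=> [i]; rewrite (negbTE (vL i)).
- move=> a l /(@free_sub_size _ (v :: L (a + l)%N)); rewrite size_map size_iota.
  have sub : {subset [seq x i | i <- iota a l] <= span (v :: L (a + l)%N)}.
    move=> _ /mapP[i /[!mem_iota]/andP[_ il] ->].
    apply: span_mono (xL i) => u.
    rewrite !inE => /predU1P[->|/(Lmono _ _ il)->].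
      by rewrite eqxx.
    by rewrite orbT.
  move=> /(_ sub) /=; rewrite sizeL => lle.
  have cnt : (count (fun i => ~~ `[< exists j, x i \in span (L j) >]) (iota a l)
      <= count (predC kept) (iota a l))%N.
    apply: sub_count => i /=; apply: contra => keepi; apply/asboolP.
    by exists i.+1; apply: sub_span; rewrite LS keepi mem_head.
  apply: (leq_trans cnt).
  have := count_predC kept (iota a l); rewrite size_iota.
  move=> lE; rewrite -(leq_add2l (count kept (iota a l))) lE (leq_trans lle)//.
  by rewrite addnC -addnS leq_add2l ltnS.
Qed.

(** A subgroup that is maximal among those containing [M] but not [v] has
    index two, and [psi] is the indicator function of its complement. *)
Lemma subgroup_separated (M : set V) v : M 0%R ->
  (forall u u', M u -> M u' -> M (u + u')%R) -> ~ M v ->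
  exists psi : V -> bool, [/\ forall u u', psi (u + u')%R = psi u (+) psi u',
    psi v = true & forall u, M u -> psi u = false].
Proof.
move=> M0 MD Mv.
pose P (H : set V) := (forall u u', H u -> H u' -> H (u + u')%R) /\ ~ H v.
(* Zorn's lemma is applied to sets [N] with [M `|` N] a subgroup, so that the
   empty chain is bounded too. *)
have [C CP Ctot|N [[HD Hv] Nmax]] := @Zorn_bigcup V [set N | P (M `|` N)].
  split=> [u u'|[//|[X CX Xv]]]; last by have [_] := CP _ CX; apply; right.
  move=> [Mu|[X CX Xu]] [Mu'|[Y CY Yu']]; first by left; apply: MD.
  - have [YD _] := CP _ CY.
    by have [] := YD u u' (or_introl Mu) (or_intror Yu');
      [left|right; exists Y].
  - have [XD _] := CP _ CX.
    by have [] := XD u u' (or_intror Xu) (or_introl Mu');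
      [left|right; exists X].
  - have [XY|YX] := Ctot _ _ CX CY.
      have [YD _] := CP _ CY.
      by have [] := YD u u' (or_intror (XY _ Xu)) (or_intror Yu');
        [left|right; exists Y].
    have [XD _] := CP _ CX.
    by have [] := XD u u' (or_intror Xu) (or_intror (YX _ Yu'));
      [left|right; exists X].
set H := M `|` N in HD Hv.
have H0 : H 0%R by left.
have Huv u : ~ H u -> H (u + v)%R.
  move=> nHu; apply: contrapT => nHuv.
  pose N' := H `|` [set a | H (a + u)%R].
  apply: (Nmax N').
    split; first by move=> a Na; left; right.
    move=> N'N; apply: nHu; right; apply: N'N; right.
    by rewrite /= addvv.
  have MN' : M `|` N' = N' by apply/setUidPr => a Ma; left; left.
  rewrite /mkset MN'.
  split=> [a b|[//|/=]]; last by rewrite addrC.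
  move=> [Ha|/= Ha] [Hb|/= Hb]; first by left; apply: HD.
  - by right; rewrite /= -addrA; apply: HD.
  - by right; rewrite /= addrAC; apply: HD.
  - left; suff -> : (a + b = (a + u) + (b + u))%R by apply: HD.
    by rewrite addrACA addvv addr0.
exists (fun u => ~~ `[< H u >]); split.
- move=> u u'.
  have [Hu|nHu] := pselect (H u); have [Hu'|nHu'] := pselect (H u').
  + by rewrite !asboolT//; apply: HD.
  + rewrite (asboolT Hu) !asboolF// => Huu'; apply: nHu'.
    by rewrite -(addvK u u'); apply: HD.
  + rewrite (asboolT Hu') !asboolF// => Huu'; apply: nHu.
    by rewrite -(addvK u' u) [(u' + u)%R]addrC; apply: HD.
  + rewrite (asboolF nHu) (asboolF nHu') asboolT//.
    suff -> : (u + u' = (u + v) + (u' + v))%R by apply: HD; apply: Huv.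
    by rewrite addrACA addvv addr0.
- by rewrite asboolF.
- by move=> u Mu; rewrite asboolT//; left.
Qed.

(** The span of finitely many terms is finite, so a sequence that takes each
    value finitely often leaves it. *)
Lemma free_subsequence x :
  (forall v, exists N, forall n, (N <= n)%N -> x n <> v) ->
  exists h : nat -> nat, (forall n, (n <= h n)%N) /\
    free_sequence (x \o h).
Proof.
move=> xinj.
have avoid s N : exists n, (N <= n)%N /\ x n \notin s.
  suff [M Mx] : exists M, forall n, (M <= n)%N -> x n \notin s.
    by exists (maxn M N); rewrite leq_maxr Mx ?leq_maxl.
  elim: s => [|v s [M Ms]]; first by exists 0.
  have [K Kv] := xinj v; exists (maxn M K) => n.
  rewrite geq_max => /andP[/Ms nM /Kv]; rewrite inE negb_or nM andbT.
  by move/eqP.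
have /choice[f fP] (sN : seq V * nat) := avoid (span sN.1) sN.2.
pose L := fix L n : seq V := if n is m.+1 then x (f (L m, m)) :: L m else [::].
exists (fun n => f (L n, n)); split=> [n|n]; first by have [] := fP (L n, n).
have LE m : L m = rev [seq x (f (L i, i)) | i <- iota 0 m].
  by elim: m => // m IHm; rewrite -addn1 iotaD map_cat rev_cat /= -IHm addn1.
rewrite -(@eq_mem_free (L n)); last 2 first.
- by move=> u; rewrite LE mem_rev.
- by rewrite LE size_rev.
by elim: n => // n IHn; rewrite /= free_cons IHn andbT; have [] := fP (L n, n).
Qed.

End BooleanSpan.

(** * Blocks of natural numbers and their ultrafilters *)

Section Blocks.

(** The [n]-th block starts at [a = block_start n] and has [n * (a + 1) + 1]
    points: removing [a + 1] points, which [greedy_subgroup] may require, any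
    fixed number [m] of times does not exhaust the blocks with [n >= m]. *)
Fixpoint block_start n : nat :=
  if n is m.+1 then (block_start m + (m * (block_start m).+1).+1)%N else 0.

Definition block n : seq nat :=
  iota (block_start n) (n * (block_start n).+1).+1.

Lemma block_start_leq m n : (m <= n)%N -> (block_start m <= block_start n)%N.
Proof.
elim: n => [|n IHn]; first by rewrite leqn0 => /eqP->.
rewrite leq_eqVlt => /predU1P[->//|/IHn mn].
by rewrite (leq_trans mn)//= leq_addr.
Qed.

Lemma mem_block i n :
  (i \in block n) = (block_start n <= i < block_start n.+1)%N.
Proof. by rewrite mem_iota. Qed.

Lemma leq_block_start n : (n <= block_start n)%N.
Proof.
by elim: n => //= n IHn; rewrite addnS ltnS (leq_trans IHn)// leq_addr.
Qed.

Lemma exists_block i : exists n, (i < block_start n.+1)%N.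
Proof. by exists i; apply: leq_block_start. Qed.

Definition block_index i : nat := ex_minn (exists_block i).

Lemma mem_block_index i n : i \in block n -> block_index i = n.
Proof.
rewrite mem_block /block_index => /andP[ni iSn]; case: ex_minnP => m iSm mmin.
apply/eqP; rewrite eqn_leq mmin//= leqNgt; apply/negP => mn.
by have := leq_trans iSm (leq_trans (block_start_leq mn) ni); rewrite ltnn.
Qed.

(** Filters of this form are what ultrafilters have to extend for the greedy
    subgroup to contain almost all terms. *)
Definition block_large (A : set nat) (S : set nat) : Prop :=
  exists m, forall n, A n ->
    (count (fun i => ~~ `[< S i >]) (block n) <= m * (block_start n).+1)%N.

Lemma block_large_filter (A : set nat) :
  (forall N, exists2 n, (N <= n)%N & A n) -> ProperFilter (block_large A).
Proof.
move=> Ainf; split.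
  move=> [m mP]; have [n mn An] := Ainf m.
  have := mP n An; rewrite (eq_count (a2 := predT)); last first.
    by move=> i; rewrite asboolF.
  by rewrite count_predT size_iota ltnNge leq_mul2r mn orbT.
split.
- exists 0 => n _; rewrite (eq_count (a2 := pred0)) ?count_pred0// => i.
  by rewrite asboolT.
- move=> S S' [m mP] [m' mP']; exists (m + m')%N => n An.
  rewrite mulnDl (leq_trans _ (leq_add (mP n An) (mP' n An)))//.
  rewrite -count_predUI (leq_trans _ (leq_addr _ _))//.
  by apply: sub_count => i /=; rewrite asbool_and negb_and.
- move=> S S' SS' [m mP]; exists m => n An; apply: leq_trans (mP n An).
  apply: sub_count => i /=; apply: contra => /asboolP Si; apply/asboolP.
  exact: SS'.
Qed.

Lemma block_large_cofinite (A : set nat) N : block_large A [set i | (N <= i)%N].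
Proof.
exists N => n _; rewrite (@leq_trans N)//; last by rewrite mulnS leq_addr.
rewrite -size_filter -[leqRHS](size_iota 0); apply: uniq_leq_size.
  by rewrite filter_uniq ?iota_uniq.
move=> i; rewrite mem_filter mem_iota /= add0n ltnNge => /andP[+ _].
by apply: contra => Ni; apply/asboolP.
Qed.

Definition ultrafilter_on (A : set nat) : set_system nat :=
  get [set p : set_system nat | UltraFilter p /\ block_large A `<=` p].

Lemma ultrafilter_onP (A : set nat) :
  (forall N, exists2 n, (N <= n)%N & A n) ->
  UltraFilter (ultrafilter_on A) /\ block_large A `<=` ultrafilter_on A.
Proof.
move=> /block_large_filter AF; rewrite /ultrafilter_on.
by case: xgetP => [p _ //|noP]; have [p /noP] := ultraFilterLemma AF.
Qed.

End Blocks.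

(** Distinct functions from a countable set to [nat] have almost disjoint sets
    of (codes of) finite initial segments. *)
Section AlmostDisjoint.
Variables (T : Type) (label : T -> seq nat -> nat).
Hypothesis label_inj : injective label.

Definition branch (t : T) n : nat :=
  pickle [seq label t (odflt [::] (unpickle i)) | i <- iota 0 n].

Definition branches (t : T) : set nat := range (branch t).

Lemma branch_inj t t' m n : branch t m = branch t' n -> m = n.
Proof.
move=> /(pcan_inj pickleK)/(congr1 size).
by rewrite !size_map !size_iota.
Qed.

Lemma branches_unbounded t N : exists2 n, (N <= n)%N & branches t n.
Proof.
apply: contrapT => noN.
have small i : (branch t i < N)%N.
  rewrite ltnNge; apply/negP => Ni; apply: noN.
  by exists (branch t i) => //; exists i.
have : (size [seq branch t i | i <- iota 0 N.+1] <= size (iota 0 N))%N.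
  apply: uniq_leq_size.
    by rewrite map_inj_uniq ?iota_uniq// => i j /branch_inj.
  by move=> _ /mapP[i _ ->]; rewrite mem_iota /= add0n.
by rewrite size_map !size_iota ltnn.
Qed.

Lemma branches_almost_disjoint t t' : t <> t' ->
  exists N, forall n, (N <= n)%N -> branches t n -> ~ branches t' n.
Proof.
move=> tt'.
have [p tp] : exists p, label t p <> label t' p.
  by apply/existsNP => tt'p; apply/tt'/label_inj/funext.
pose f i := label t (odflt [::] (unpickle i)).
have [N NP] : exists N, forall k, (k <= pickle p)%N -> (branch t k < N)%N.
  elim: (pickle p) => [|k [N NP]].
    by exists (branch t 0).+1 => k; rewrite leqn0 => /eqP->.
  exists (maxn N (branch t k.+1).+1) => j.
  rewrite leq_eqVlt leq_max => /predU1P[->|/NP->//]; by rewrite ltnSn orbT.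
exists N => n Nn [k _ kn] [k' _ k'n].
have := kn; rewrite -k'n => kk'; have kk := branch_inj kk'; subst k'.
have pk : (pickle p < k)%N.
  by rewrite ltnNge; apply/negP => /NP; rewrite kn ltnNge Nn.
move: kk' => /(pcan_inj pickleK)/eq_in_map/(_ (pickle p)).
by rewrite mem_iota add0n pk pickleK => /(_ isT).
Qed.

End AlmostDisjoint.

Section Separation.
Variables (V : zmodType) (T : Type) (A : T -> set nat).
Hypothesis addvv : forall v : V, (v + v = 0)%R.
Hypothesis Aad : forall t t', t <> t' ->
  exists N, forall n, (N <= n)%N -> A t n -> ~ A t' n.

(** Enumerate [D] and let the owner of [n] be the first [t] with [n] in [A t];
    [t] loses only the finitely many [n] that it shares with the finitely many
    earlier elements. *)
Lemma almost_disjoint_owner (D : set T) : countable D ->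
  exists o : nat -> option T, forall t, D t ->
    exists N, forall n, (N <= n)%N -> A t n -> o n = Some t.
Proof.
move=> /countable_injP[f finj].
have finj' t t' : D t -> D t' -> f t = f t' -> t = t'.
  by move=> Dt Dt'; apply: finj; rewrite inE.
pose least n t :=
  [/\ D t, A t n & forall t', D t' -> A t' n -> (f t <= f t')%N].
have /choice[o oP] n : exists o : option T,
    if o is Some t then least n t else forall t, ~ least n t.
  have [[t tP]|not] := pselect (exists t, least n t); first by exists (Some t).
  by exists None => t tP; apply: not; exists t.
exists o => t Dt.
have [N NP] : exists N, forall t', D t' -> (f t' < (f t).+1)%N -> t <> t' ->
    forall n, (N <= n)%N -> A t n -> ~ A t' n.
  elim: (f t).+1 => [|k [N NP]]; first by exists 0.
  have [[s [Ds fs]]|nok] := pselect (exists s, D s /\ f s = k); last first.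
    exists N => t' Dt'.
    rewrite ltnS leq_eqVlt => /predU1P[ft'|]; last exact: NP.
    by case: nok; exists t'.
  have [ts|ts] := pselect (t = s).
    exists N => t' Dt'.
    rewrite ltnS leq_eqVlt => /predU1P[ft'|]; last exact: NP.
    by case; rewrite ts; apply: finj'; rewrite ?fs.
  have [M MP] := Aad ts; exists (maxn N M) => t' Dt' + tt' n.
  rewrite ltnS leq_eqVlt geq_max => /predU1P[ft'|ft'] /andP[Nn Mn].
    by have -> : t' = s; [apply: finj'; rewrite ?fs|apply: MP].
  exact: NP.
exists N => n Nn At; have := oP n; case: (o n) => [t0 [Dt0 At0 fle]|].
  congr Some; apply: contrapT => t0t.
  by apply: (NP t0 Dt0 _ _ n) => //; [rewrite ltnS; apply: fle|move=> /esym].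
move=> /(_ t); case; split => // t' Dt' At'; rewrite leqNgt; apply/negP => ft'.
have tt' : t <> t' by move=> tE; rewrite tE ltnn in ft'.
by apply: (NP t' Dt' _ tt' n) => //; apply: ltnW.
Qed.

(** With one owner for each block, the countably many sequences combine into
    a single one whose restriction to every block is part of one independent
    sequence, and [greedy_subgroup] applies to it.  For each [t] the rejected
    terms are at most [a + 1] in every block owned by [t], and the blocks of [t]
    owned by others are finitely many. *)
Lemma separating_subgroup (D : set T) (g : T -> nat -> V) (v : V) :
  countable D -> (forall t, D t -> free_sequence (g t)) -> v <> 0%R ->
  exists M : set V,
    [/\ M 0%R, forall u u', M u -> M u' -> M (u + u')%R, ~ M v &
        forall t, D t -> block_large (A t) [set i | M (g t i)]].
Proof.
move=> Dc gfree v0.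
have [o oP] := almost_disjoint_owner Dc.
pose x i := if o (block_index i) is Some t then g t i else 0%R.
have [M [M0 MD Mv Mcount]] := greedy_subgroup addvv x v0.
exists M; split => // t Dt.
(* The factor [(block_start N).+1] absorbs the blocks before the [N]-th one,
   which [t] may fail to own and which have at most [block_start N] points. *)
have [N NP] := oP t Dt; exists (block_start N).+1 => n An.
have [Nn|nN] := leqP N n; last first.
  rewrite (leq_trans (count_size _ _))// size_iota.
  apply: (@leq_trans (block_start N).+1); last by rewrite leq_pmulr.
  by apply: leqW (leq_trans _ (block_start_leq nN)); apply: leq_addl.
have xg : {in block n, x =1 g t}.
  by move=> i /mem_block_index ni; rewrite /x ni NP.
rewrite mulSn (leq_trans _ (leq_addr _ _))//.
rewrite (@eq_in_count _ _ (fun i => ~~ `[< M (x i) >])); last first.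
  by move=> i /xg /= ->.
apply: Mcount; rewrite ((eq_in_map _ _ _).1 xg).
exact: free_sequence_iota (gfree t Dt).
Qed.

End Separation.

(** * The free boolean group on a set *)

Definition parity (T : Type) (s : seq T) (phi : T -> bool) : bool :=
  odd (count phi s).

(** A finite subset of [T], up to symmetric difference, is encoded by the
    parity that it assigns to the predicates on [T].  In this form the
    universal property is mere evaluation: a map [phi : T -> bool] extends to
    the homomorphism [fun v => v phi]. *)
Record free_boolean (T : Type) := FreeBoolean {
  eval :> (T -> bool) -> bool;
  eval_parity : exists s, eval = parity s }.

HB.instance Definition _ T := gen_eqMixin (free_boolean T).
HB.instance Definition _ T := gen_choiceMixin (free_boolean T).

Section FreeBoolean.
Variable T : Type.
Implicit Types (u v : free_boolean T) (s : seq T) (phi psi : T -> bool).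

Lemma eval_inj u v : u =1 v -> u = v.
Proof.
case: u v => [u up] [v vp] /= /funext uv; subst v.
by congr FreeBoolean; apply: Prop_irrelevance.
Qed.

Definition subset_sum s : free_boolean T :=
  FreeBoolean (ex_intro (fun s' => parity s = parity s') s erefl).

Lemma subset_sumP v : exists s, v = subset_sum s.
Proof.
have [s vs] := eval_parity v.
by exists s; apply: eval_inj => phi; rewrite vs.
Qed.

Lemma parity_cat s s' phi :
  parity (s ++ s') phi = parity s phi (+) parity s' phi.
Proof. by rewrite /parity count_cat oddD. Qed.

Lemma parityD s phi psi :
  parity s (fun t => phi t (+) psi t) = parity s phi (+) parity s psi.
Proof.
rewrite /parity; elim: s => //= t s IHs.
by rewrite !oddD IHs !oddb addbACA.
Qed.

Lemma eval_addP u v : exists s, (fun phi => u phi (+) v phi) = parity s.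
Proof.
have [[s ->] [s' ->]] := (eval_parity u, eval_parity v).
by exists (s ++ s'); apply/funext => phi; rewrite parity_cat.
Qed.

Definition bool_add u v : free_boolean T := FreeBoolean (eval_addP u v).

Lemma bool_addA : associative bool_add.
Proof. by move=> u v w; apply: eval_inj => phi /=; rewrite addbA. Qed.

Lemma bool_addC : commutative bool_add.
Proof. by move=> u v; apply: eval_inj => phi /=; rewrite addbC. Qed.

Lemma bool_add0 : left_id (subset_sum [::]) bool_add.
Proof. by move=> u; apply: eval_inj. Qed.

Lemma bool_addN : left_inverse (subset_sum [::]) id bool_add.
Proof. by move=> u; apply: eval_inj => phi /=; rewrite addbb. Qed.

HB.instance Definition _ := GRing.isZmodule.Build (free_boolean T)
  bool_addA bool_addC bool_add0 bool_addN.

Lemma evalD u v phi : (u + v)%R phi = u phi (+) v phi. Proof. by []. Qed.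

Lemma free_boolean_addvv v : (v + v = 0)%R.
Proof. exact: bool_addN. Qed.

Lemma evalDr v phi psi : v (fun t => phi t (+) psi t) = v phi (+) v psi.
Proof. by have [s ->] := subset_sumP v; apply: parityD. Qed.

Definition point (t : T) : free_boolean T := subset_sum [:: t].

Lemma point_eval t phi : point t phi = phi t.
Proof. by rewrite /= /parity /= addn0 oddb. Qed.

Lemma point_inj : injective point.
Proof.
move=> t t' tt'; have := point_eval t (fun x => `[< x = t' >]).
by rewrite tt' point_eval asboolT// => /esym/asboolP.
Qed.

End FreeBoolean.

Lemma subset_sum_additive (T : eqType) (psi : free_boolean T -> bool) s phi :
  (forall u v, psi (u + v)%R = psi u (+) psi v) ->
  (forall t, t \in s -> phi t = psi (point t)) ->
  psi (subset_sum s) = subset_sum s phi.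
Proof.
move=> psiD; elim: s => [_|t s IHs phis].
  have := psiD 0%R 0%R; rewrite addr0 addbb => psi0.
  by rewrite -[RHS]psi0; congr psi; apply: eval_inj.
have -> : subset_sum (t :: s) = (point t + subset_sum s)%R.
  by apply: eval_inj => chi; rewrite evalD point_eval /= /parity /= oddD oddb.
rewrite psiD evalD IHs; last first.
  by move=> t' st'; apply: phis; rewrite inE st' orbT.
by rewrite point_eval phis// mem_head.
Qed.


(** * Trees as points of the limit group *)

(** The tree [Limit c g] names the sequence whose [n]-th term is the sum of the
    trees [g n j] with [j < c n].  Every sequence of finite sets of trees is
    named, as for a set of trees built in stages up to the first uncountable
    ordinal, and the structure of trees provides the recursion. *)
Inductive tree : Type :=
| Leaf : tree
| Limit : (nat -> nat) -> (nat -> nat -> tree) -> tree.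

HB.instance Definition _ := gen_eqMixin tree.
HB.instance Definition _ := gen_choiceMixin tree.

(** Labels of the nodes along finite paths determine a tree; this bounds the
    number of trees by the continuum, which is what an almost disjoint family
    of subsets of [nat] indexed by trees requires. *)
Fixpoint tree_label (t : tree) (p : seq nat) : nat :=
  match t, p with
  | Leaf, _ => 0
  | Limit _ _, [::] => 1
  | Limit c _, [:: n] => c n
  | Limit _ g, [:: n, j & p'] => tree_label (g n j) p'
  end.

Lemma tree_label_inj : injective tree_label.
Proof.
elim=> [|c g IHg] [|c' g'] //= E; try by have := congr1 (@^~ [::]) E.
congr Limit; first by apply/funext => n; have := congr1 (@^~ [:: n]) E.
apply/funext => n; apply/funext => j; apply: IHg; apply/funext => p.
by have := congr1 (@^~ [:: n, j & p]) E.
Qed.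

Definition children (t : tree) (n : nat) : seq tree :=
  if t is Limit c g then [seq g n j | j <- iota 0 (c n)] else [::].

Definition terms (t : tree) (n : nat) : free_boolean tree :=
  subset_sum (children t n).

Definition dissociated (t : tree) : Prop := free_sequence (terms t).

(** The function [terms] reads [g n] only below [c n]; different values beyond
    it give a sequence two names, which become two cluster points. *)
Lemma terms_surj (x : nat -> free_boolean tree) :
  exists t t', [/\ t <> t', terms t = x & terms t' = x].
Proof.
have /choice[s sx] n := subset_sumP (x n).
pose mk d := Limit (fun n => size (s n)) (fun n j => nth d (s n) j).
have mkP d : terms (mk d) = x.
  by apply/funext => n; rewrite sx /terms /= -[in RHS](mkseq_nth d (s n)).
exists (mk Leaf), (mk (mk Leaf)); split=> // -[].
move=> /(congr1 (fun g => g 0 (size (s 0)))).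
by rewrite !nth_default.
Qed.

Lemma tree_acyclic c g n j : g n j <> Limit c g.
Proof.
suff H t : forall c g n j, t = Limit c g -> g n j <> t by exact: (H _ c g).
elim: t => {c g n j} [//|c g IHg] c' g' n j [_ <-] gE.
exact: (IHg n j _ _ n j gE erefl).
Qed.

(** A tree is not among its own children, so [terms t] and [point t] are
    separated by the indicator function of [t]. *)
Lemma terms_self (t : tree) n : terms t n (fun t' => `[< t' = t >]) = false.
Proof.
case: t => [//|c g]; rewrite /= /parity count_map.
rewrite (eq_count (a2 := pred0)) ?count_pred0// => j /=.
by rewrite asboolF//; apply: tree_acyclic.
Qed.

Fixpoint subtrees (t : tree) : set tree :=
  if t is Limit c g then
    [set t] `|` \bigcup_n \bigcup_j subtrees (g n j)
  else [set t].

Lemma subtrees_refl t : subtrees t t.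
Proof. by case: t => [|c g]; [|left]. Qed.

Lemma subtrees_countable t : countable (subtrees t).
Proof.
elim: t => [|c g IHg] /=; first exact: countable1.
rewrite -bigcup2E; apply: bigcup_countable => // -[|[|i]] _ //=.
by apply: bigcup_countable => // n _; apply: bigcup_countable => // j _.
Qed.

Lemma subtrees_children t t' n u :
  subtrees t t' -> u \in children t' n -> subtrees t u.
Proof.
elim: t => [-> //|c g IHg] /= [->|[m _ [j _ gt']]] ut'; right; last first.
  by exists m => //; exists j => //; apply: IHg ut'.
case/mapP: ut' => j _ ->.
by exists n => //; exists j => //; apply: subtrees_refl.
Qed.

Definition tree_ultrafilter (t : tree) : set_system nat :=
  ultrafilter_on (branches tree_label t).

Lemma tree_ultrafilterP t : UltraFilter (tree_ultrafilter t).
Proof. by have [] := ultrafilter_onP (branches_unbounded tree_label t). Qed.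

Lemma block_large_ultrafilter t :
  block_large (branches tree_label t) `<=` tree_ultrafilter t.
Proof. by have [] := ultrafilter_onP (branches_unbounded tree_label t). Qed.

#[local] Instance tree_ultrafilter_filter t : Filter (tree_ultrafilter t).
Proof. by have [UP _] := tree_ultrafilterP t; apply: filter_filter. Qed.

(** Says that [point t] is the limit of [terms t] along the ultrafilter of [t],
    as far as [phi] can see.  No condition is imposed for dependent sequences,
    for which the separation argument would break down. *)
Definition respects_limits (phi : tree -> bool) : Prop :=
  forall t, dissociated t ->
    tree_ultrafilter t [set n | terms t n phi = phi t].

Record limit_char := LimitChar {
  limit_char_fun :> tree -> bool;
  limit_charP : respects_limits limit_char_fun }.

HB.instance Definition _ := gen_eqMixin limit_char.
HB.instance Definition _ := gen_choiceMixin limit_char.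

Lemma limit_char_inj (phi psi : limit_char) : phi =1 psi -> phi = psi.
Proof.
case: phi psi => [phi phiP] [psi psiP] /= /funext E; subst psi.
by congr LimitChar; apply: Prop_irrelevance.
Qed.

Lemma respects_limits0 : respects_limits (fun=> false).
Proof.
move=> t _; apply: (filterS _ filterT) => n _ /=.
by rewrite /parity (eq_count (a2 := pred0)) ?count_pred0.
Qed.

Lemma respects_limitsD (phi psi : limit_char) :
  respects_limits (fun t => phi t (+) psi t).
Proof.
move=> t td; apply: filterS2 (limit_charP phi td) (limit_charP psi td) => n.
by move=> <- <-; apply: evalDr.
Qed.

Definition limit_char0 := LimitChar respects_limits0.
Definition limit_char_add phi psi := LimitChar (respects_limitsD phi psi).

Lemma limit_char_addA : associative limit_char_add.
Proof. by move=> u v w; apply: limit_char_inj => phi /=; rewrite addbA. Qed.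

Lemma limit_char_addC : commutative limit_char_add.
Proof. by move=> u v; apply: limit_char_inj => phi /=; rewrite addbC. Qed.

Lemma limit_char_add0 : left_id limit_char0 limit_char_add.
Proof. by move=> u; apply: limit_char_inj. Qed.

Lemma limit_char_addN : left_inverse limit_char0 id limit_char_add.
Proof. by move=> u; apply: limit_char_inj => phi /=; rewrite addbb. Qed.

HB.instance Definition _ := GRing.isZmodule.Build limit_char
  limit_char_addA limit_char_addC limit_char_add0 limit_char_addN.

(** Extension of a function prescribed on [D] by taking limits along the
    ultrafilters. *)
Section Extension.
Variables (D : set tree) (psi : tree -> bool).

Fixpoint limit_extension (t : tree) : bool :=
  if `[< D t >] then psi t else
  if t is Limit c g then
    `[< tree_ultrafilter t
          [set n | odd (count (fun j => limit_extension (g n j))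
                              (iota 0 (c n)))] >]
  else false.

Lemma limit_extension_in t : D t -> limit_extension t = psi t.
Proof. by move=> Dt; case: t Dt => [|c g] Dt; rewrite /= asboolT. Qed.

Lemma limit_extension_out t : ~ D t -> dissociated t ->
  tree_ultrafilter t [set n | terms t n limit_extension = limit_extension t].
Proof.
move=> nDt td; case: t nDt td => [|c g] nDt td.
  have := td 1; rewrite /= (free_cons (@free_boolean_addvv tree)).
  by rewrite (span0 (@free_boolean_addvv tree)).
set phi := limit_extension.
have phiE : phi (Limit c g) =
    `[< tree_ultrafilter (Limit c g) [set n | terms (Limit c g) n phi] >].
  rewrite {1}/phi /= (asboolF nDt); congr asbool; congr tree_ultrafilter.
  by apply/funext => n; rewrite /mkset /parity count_map.
pose S := [set n | terms (Limit c g) n phi].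
rewrite phiE -/S; have [pS|pS] := pselect (tree_ultrafilter (Limit c g) S).
  by rewrite asboolT.
rewrite asboolF//.
have [//|] := in_ultra_setVsetC S (tree_ultrafilterP (Limit c g)).
by apply: filterS => n /negP/negbTE.
Qed.

End Extension.

(** Let [D] consist of the subtrees of the trees in [v]; it is countable.  By
    [separating_subgroup], applied to the sequences [terms t n + t], there is a
    homomorphism [psi] with [psi v = true] and
    [psi (terms t n) = psi (point t)] for almost all [n], for [t] in [D]; it is
    then extended from [D] to all trees. *)
Lemma limit_chars_separate (v : free_boolean tree) :
  v <> 0%R -> exists phi : limit_char, v phi = true.
Proof.
move=> v0; have [s vs] := subset_sumP v.
pose D := \bigcup_(t in [set t | t \in s]) subtrees t.
have Dcountable : countable D.
  apply: bigcup_countable => [|t _]; last exact: subtrees_countable.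
  exact/finite_set_countable/finite_seq.
have Dchildren t n u : D t -> u \in children t n -> D u.
  by move=> [r rs rt] tu; exists r => //; apply: subtrees_children rt tu.
pose g (t : tree) n := (terms t n + point t)%R.
have gfree t : (D `&` dissociated) t -> free_sequence (g t).
  move=> [_ td]; apply: (free_sequence_shift (@free_boolean_addvv tree)
    (psi := fun u => eval u (fun t' => `[< t' = t >])) _ _ _ td) => //.
    by rewrite point_eval asboolT.
  exact: terms_self.
have Dd : countable (D `&` dissociated).
  by apply: sub_countable Dcountable; apply: subset_card_le => t [].
have [M [M0 MD Mv Mlarge]] := separating_subgroup (@free_boolean_addvv tree)
  (branches_almost_disjoint tree_label_inj) Dd gfree v0.
have [psi [psiD psiv psiM]] :=
  subgroup_separated (@free_boolean_addvv tree) M0 MD Mv.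
pose phi := limit_extension D (psi \o @point tree).
have phiD r : (forall t, t \in r -> D t) ->
    subset_sum r phi = psi (subset_sum r).
  move=> rD; rewrite (subset_sum_additive (phi := phi) psiD)// => t /rD Dt.
  by rewrite /phi limit_extension_in.
have phiP : respects_limits phi.
  move=> t td; have [Dt|nDt] := pselect (D t); last exact: limit_extension_out.
  apply: block_large_ultrafilter.
  have [m mP] := Mlarge t (conj Dt td).
  exists m => n An; apply: leq_trans (mP n An).
  apply: sub_count => i /=; apply: contra => /asboolP /psiM.
  rewrite psiD => psi0.
  apply/asboolP; rewrite -[LHS]/(subset_sum (children t i) phi).
  rewrite phiD; last by move=> u; apply: Dchildren.
  rewrite /phi limit_extension_in//= -/(terms t i); move: psi0.
  by case: (psi (terms t i)); case: (psi (point t)).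
exists (LimitChar phiP); rewrite -[LHS]/(v phi) vs phiD -?vs// => t st.
by exists t => //; apply: subtrees_refl.
Qed.

Lemma limit_pair_eq0 (v : free_boolean tree) :
  (forall phi : limit_char, v phi = false) -> v = 0%R.
Proof.
move=> v0; apply: contrapT => /limit_chars_separate[phi].
by rewrite v0.
Qed.

Lemma limit_pair_eq0l (phi : limit_char) :
  (forall v : free_boolean tree, v phi = false) -> phi = 0%R.
Proof.
by move=> phi0; apply: limit_char_inj => t; rewrite -point_eval phi0.
Qed.

Definition limit_pairing : pairing (free_boolean tree) limit_char :=
  @Pairing (free_boolean tree) limit_char (fun phi v => v phi)
    (fun phi psi v => evalDr v phi psi) (fun phi u v => evalD u v phi)
    limit_pair_eq0l limit_pair_eq0.

(** If no value is repeated infinitely often, an independent subsequence is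
    [terms t] for some [t], and [point t] is a cluster point. *)
Lemma limit_pairing_cluster (u : nat -> free_boolean tree) : exists v,
  forall (s : seq limit_char) N, exists2 n, (N <= n)%N &
    forall phi, phi \in s -> limit_pairing phi (u n) = limit_pairing phi v.
Proof.
have [[v vP]|novalue] := pselect
  (exists v, forall N, exists2 n, (N <= n)%N & u n = v).
  by exists v => s N; have [n Nn <-] := vP N; exists n.
have [|h [hn hfree]] := @free_subsequence _ (@free_boolean_addvv tree) u.
  move=> v; apply: contrapT => noN; apply: novalue; exists v => N.
  apply: contrapT => noNn; apply: noN.
  by exists N => n Nn un; apply: noNn; exists n.
have [t [_ [_ tu _]]] := terms_surj (u \o h).
have td : dissociated t by rewrite /dissociated tu.
exists (point t) => s N.
have tN : tree_ultrafilter t [set n | (N <= n)%N].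
  exact/block_large_ultrafilter/block_large_cofinite.
have ts : tree_ultrafilter t [set n | forall phi, phi \in s ->
    limit_pairing phi (terms t n) = limit_pairing phi (point t)].
  elim: s => [|phi s IHs]; first by apply: (filterS _ filterT).
  apply: filterS2 (limit_charP phi td) IHs => n nphi ns chi; rewrite inE.
  move=> /predU1P[->|/ns//].
  by rewrite -[LHS]/(terms t n phi) nphi -[RHS]/(point t phi) point_eval.
have [ult_proper _] := tree_ultrafilterP t.
have [n [Nn ns]] := filter_ex (filterI tN ts).
exists (h n); first exact: leq_trans (hn n).
by move=> phi /ns; rewrite tu.
Qed.

(** A convergent sequence that is not eventually constant has an independent
    subsequence, named by two trees [t] and [t'] whose points would both be its
    limit. *)
Lemma limit_pairing_no_convergent (u : nat -> free_boolean tree) l :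
  (forall phi,
    \forall n \near \oo, limit_pairing phi (u n) = limit_pairing phi l) ->
  \forall n \near \oo, u n = l.
Proof.
move=> ul; apply: contrapT => nul.
have /choice[k kP] N : exists n, (N <= n)%N /\ u n <> l.
  apply: contrapT => noN; apply: nul; exists N => // n /= Nn.
  by apply: contrapT => unl; apply: noN; exists n.
(* A value other than [l] is excluded far out by a character separating it
   from [l]. *)
have finite_to_one v : exists N, forall n, (N <= n)%N -> (u \o k) n <> v.
  have [->|/eqP vl] := eqVneq v l; first by exists 0 => n _; have [] := kP n.
  have [phi] : exists phi : limit_char, (v - l)%R phi = true.
    by apply: limit_chars_separate => /subr0_eq.
  rewrite (oppv (@free_boolean_addvv tree)) evalD => vlphi.
  have [N _ NP] := ul phi; exists N => n Nn /= uv.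
  have := NP _ (leq_trans Nn (kP n).1); rewrite /= uv => E.
  by rewrite E addbb in vlphi.
have [h [hn hfree]] :=
  free_subsequence (@free_boolean_addvv tree) finite_to_one.
have [t [t' [tt' tu t'u]]] := terms_surj ((u \o k) \o h).
have limE r : terms r = (u \o k) \o h -> point r = l.
  move=> ru; apply/subr0_eq/limit_pair_eq0 => phi.
  have rd : dissociated r by rewrite /dissociated ru.
  have [N _ NP] := ul phi.
  have rN : tree_ultrafilter r [set n | (N <= n)%N].
    exact/block_large_ultrafilter/block_large_cofinite.
  have [ult_proper _] := tree_ultrafilterP r.
  have [n [Nn]] := filter_ex (filterI rN (limit_charP phi rd)).
  rewrite /mkset ru => xphi.
  have lphi : phi r = l phi.
    rewrite -xphi; apply: NP.
    exact: leq_trans Nn (leq_trans (hn n) (kP (h n)).1).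
  by rewrite (oppv (@free_boolean_addvv tree)) evalD point_eval lphi addbb.
by apply: tt'; apply: point_inj; rewrite (limE t)// (limE t').
Qed.

Theorem theorem8p3 :
  exists (G : groupType) (T : topology_on G),
    [/\ infinite_set [set: G],
        minimal_topological_group T,
        nilpotent_of_class G 2,
        no_nontrivial_convergent_sequence (topologize T)
      & exists H : set G,
          [/\ opens T H, normal_subgroup H
            & @countably_compact (topologize T) H]].
Proof.
exists (heisenberg limit_pairing), (heis_topology limit_pairing); split.
- pose e n : heisenberg limit_pairing :=
    (false, point (Limit (fun=> n) (fun _ _ => Leaf)), 0%R).
  have einj : injective e.
    move=> m n /(congr1 (fun x : heisenberg limit_pairing => x.1.2)) mn.
    by have := congr1 (fun t => if t is Limit c _ then c 0 else 0)
                      (point_inj mn).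
  move=> Gfin; apply: infinite_nat.
  rewrite -(eq_finite_set (inj_card_eq (in2W einj))).
  exact: sub_finite_set Gfin.
- exact: heis_minimal.
- apply: (@heis_nilpotent _ _ _ (point Leaf)).
  move=> /(congr1 (fun u => eval u xpredT)).
  by rewrite point_eval.
- exact/heis_no_convergent/limit_pairing_no_convergent.
- exists (base_subgroup (w := limit_pairing)); split.
  + exact: base_subgroup_open.
  + exact: base_subgroup_normal.
  + exact/base_subgroup_countably_compact/limit_pairing_cluster.
Qed.
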